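(* Let $P(\vec n,\vec x)$ be an algebraic sum of arithmetic terms, let $k\ge 1$ be the length of the tuple $\vec x$, and let $t(\vec n)$ be an arithmetic term exceeding one. Then there is an arithmetic term in the variables $\vec n$, built up by using the Hamming weight and generalized geometric progressions, that represents the cardinality of the set $$\{\vec a\in\{0,\dots,t(\vec n)-1\}^k : P(\vec n,\vec a)=0\}.$$
   Context: $\mathbb N=\{0,1,2,\dots\}$ and all variables range over $\mathbb N$. An arithmetic term in variables $n_1,\dots,n_r$ is an element of the smallest set of expressions containing $\mathbb N\cup\{n_1,\dots,n_r\}$ and closed under the binary operations $x+y$, $x\mathbin{\dot-}y=\max(x-y,0)$, $\lfloor x/y\rfloor$, $x^y$ on $\mathbb N$, with conventions $0^0=1$ and $\lfloor x/0\rfloor=0$. An algebraic sum of arithmetic terms is a sum in which each summand is an arithmetic term or the opposite (negative) of an arithmetic term. An arithmetic term represents a function of $\vec n$ if it takes the same value for all arguments. The Hamming weight $\mathrm{HW}(n)$ is the number of ones in the binary representation of $n$. The generalized geometric progression of the $r$-th kind is $G_r(q,t)=\sum_{k=0}^t k^r q^k$ (for integers $q>1$, $r\ge0$, $t\ge0$). The Hamming weight, and $G_r$ for each fixed $r$, are known to be representable by arithmetic terms and are used as building blocks. *)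

(* Defs.v *)
From mathcomp Require Import all_boot all_order all_algebra.

Set Implicit Arguments.
Unset Strict Implicit.
Unset Printing Implicit Defensive.

Inductive aterm (r : nat) : Type :=
| AVar of 'I_r
| ACst of nat
| AAdd of aterm r & aterm r
| AMonus of aterm r & aterm r
| AQuo of aterm r & aterm r
| APow of aterm r & aterm r.

Arguments ACst {r}.

(* On nat, [-] is truncated, [x %/ 0 = 0] and [0 ^ 0 = 1]. *)
Fixpoint aeval r (T : aterm r) (n : r.-tuple nat) : nat :=
  match T with
  | AVar i => tnth n i
  | ACst c => c
  | AAdd T1 T2 => aeval T1 n + aeval T2 n
  | AMonus T1 T2 => aeval T1 n - aeval T2 n
  | AQuo T1 T2 => aeval T1 n %/ aeval T2 n
  | APow T1 T2 => aeval T1 n ^ aeval T2 n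
  end.

Fixpoint asubst m r (T : aterm m) (s : m.-tuple (aterm r)) : aterm r :=
  match T with
  | AVar i => tnth s i
  | ACst c => ACst c
  | AAdd T1 T2 => AAdd (asubst T1 s) (asubst T2 s)
  | AMonus T1 T2 => AMonus (asubst T1 s) (asubst T2 s)
  | AQuo T1 T2 => AQuo (asubst T1 s) (asubst T2 s)
  | APow T1 T2 => APow (asubst T1 s) (asubst T2 s)
  end.

(* Each summand is a term together with a sign; [true] means that the opposite
   of the term is taken. *)
Definition algebraic_sum (r : nat) : Type := seq (bool * aterm r).

Definition sum_eval r (P : algebraic_sum r) (n : r.-tuple nat) : int :=
  (\sum_(s <- P) (-1) ^+ s.1 * (aeval s.2 n)%:Z)%R.

(* [odd (n %/ 2 ^ i)] is the i-th binary digit of n; since n < 2 ^ n, all the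
   digits of index at least n vanish. *)
Definition HW (n : nat) : nat := \sum_(i < n) odd (n %/ 2 ^ i).

Definition GP (j q t : nat) : nat := \sum_(k < t.+1) k ^ j * q ^ k.

(* Expressions built from the operations of arithmetic terms together with
   symbols for the Hamming weight and for each G_j. *)
Inductive hgterm (r : nat) : Type :=
| HVar of 'I_r
| HCst of nat
| HAdd of hgterm r & hgterm r
| HMonus of hgterm r & hgterm r
| HQuo of hgterm r & hgterm r
| HPow of hgterm r & hgterm r
| HHW of hgterm r
| HGP of nat & hgterm r & hgterm r.

Fixpoint heval r (E : hgterm r) (n : r.-tuple nat) : nat :=
  match E with
  | HVar i => tnth n i
  | HCst c => c
  | HAdd E1 E2 => heval E1 n + heval E2 n
  | HMonus E1 E2 => heval E1 n - heval E2 n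
  | HQuo E1 E2 => heval E1 n %/ heval E2 n
  | HPow E1 E2 => heval E1 n ^ heval E2 n
  | HHW E1 => HW (heval E1 n)
  | HGP j E1 E2 => GP j (heval E1 n) (heval E2 n)
  end.

(* G_j(q, t) is only considered for q > 1: every ratio occurring in E must
   exceed one for all values of the variables. *)
Fixpoint admissible r (E : hgterm r) : Prop :=
  match E with
  | HVar _ | HCst _ => True
  | HAdd E1 E2 | HMonus E1 E2 | HQuo E1 E2 | HPow E1 E2 =>
      admissible E1 /\ admissible E2
  | HHW E1 => admissible E1
  | HGP _ E1 E2 =>
      [/\ admissible E1, admissible E2 & forall n, 1 < heval E1 n]
  end.

Fixpoint uses_HW r (E : hgterm r) : bool :=
  match E with
  | HVar _ | HCst _ => false
  | HAdd E1 E2 | HMonus E1 E2 | HQuo E1 E2 | HPow E1 E2 | HGP _ E1 E2 =>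
      uses_HW E1 || uses_HW E2
  | HHW _ => true
  end.

Fixpoint uses_GP r (E : hgterm r) : bool :=
  match E with
  | HVar _ | HCst _ => false
  | HAdd E1 E2 | HMonus E1 E2 | HQuo E1 E2 | HPow E1 E2 =>
      uses_GP E1 || uses_GP E2
  | HHW E1 => uses_GP E1
  | HGP _ _ _ => true
  end.

Fixpoint expand (hw : aterm 1) (gp : nat -> aterm 2) r (E : hgterm r) :
    aterm r :=
  match E with
  | HVar i => AVar i
  | HCst c => ACst c
  | HAdd E1 E2 => AAdd (expand hw gp E1) (expand hw gp E2)
  | HMonus E1 E2 => AMonus (expand hw gp E1) (expand hw gp E2)
  | HQuo E1 E2 => AQuo (expand hw gp E1) (expand hw gp E2)
  | HPow E1 E2 => APow (expand hw gp E1) (expand hw gp E2)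
  | HHW E1 => asubst hw [tuple expand hw gp E1]
  | HGP j E1 E2 => asubst (gp j) [tuple expand hw gp E1; expand hw gp E2]
  end.

Definition represents_HW (hw : aterm 1) : Prop :=
  forall x : nat, aeval hw [tuple x] = HW x.

Definition represents_GP (j : nat) (g : aterm 2) : Prop :=
  forall q t : nat, 1 < q -> aeval g [tuple q; t] = GP j q t.

(* hw and gp are existential: that HW and every G_j are representable by
   arithmetic terms is asserted, not assumed. For ratios q > 1 the choice of
   hw and gp does not affect the values of the expansion. *)
Definition built_from_HW_GP r (T : aterm r) : Prop :=
  exists (hw : aterm 1) (gp : nat -> aterm 2) (E : hgterm r),
    [/\ represents_HW hw,
        forall j, represents_GP j (gp j),
        admissible E,
        uses_HW E && uses_GP E
      & T = expand hw gp E].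

Definition solutions r k (P : algebraic_sum (r + k)) (n : r.-tuple nat)
    (b : nat) : {set k.-tuple 'I_b} :=
  [set a : k.-tuple 'I_b
     | sum_eval P (cat_tuple n (map_tuple (@nat_of_ord b) a)) == 0%R].

(* Main.v *)
Require Import Defs.
From mathcomp Require Import all_boot all_order all_algebra zify ring.

(** The proof is the hypercube method. If numbers d_c <= 2^u, indexed by the
    points c of a box of side B and dimension N, are written as the digits in
    base 2^(2u) of a single number M, then the Hamming weight of (2^u - 1) M
    counts the nonzero d_c: a nonzero d_c turns into a digit block with exactly
    u ones ([HW_mul_ones]), and the blocks do not interfere
    ([HW_count_nonzero_box]). So the zeros of d in the box number
    B^N - HW((2^u - 1) M) / u, and only M remains to be written as a term.

    When d_c is a sum of monomials, that is of products of factors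
    x^alpha (2^beta)^x over the coordinates x of c, the sum M factors into one
    sum per coordinate, and each of these is a generalized geometric
    progression ([hrep_mono_box_sum]). This covers every d_c built from the
    parameters, the coordinates and the powers 2^x by addition and
    multiplication, in particular the sum of the squared differences of the
    two sides of a finite system of equations between such expressions
    ([hrep_count]).

    An arbitrary arithmetic term does not have this shape, but its graph is
    the solution set of such a system once auxiliary unknowns are added
    ([definable_aterm]). Truncated subtraction and division with remainder are
    polynomial conditions, and x^y is the remainder of (2^m)^y modulo 2^m - x
    for large m. Two features make this usable for counting: the auxiliary
    unknowns are functions of the given ones, so that solutions are neither
    lost nor multiplied, and they are bounded by an iterated power of two, so
    that one box contains them all. The problem itself is the vanishing of one
    arithmetic term, which also enforces x < t ([defect_eq0]).

    Finally, HW and the G_j have to be shown representable by arithmetic terms.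
    For G_j this is summation by parts ([GP_rec]). The number HW(n) is the
    exponent of 2 in the central binomial coefficient C(2n, n)
    ([logn_central_bin]); binomial coefficients are digits of a power of
    1 + Z, the power of two is isolated by a gcd, which is a remainder of a
    geometric progression ([gcd_as_geometric_sum]), and its exponent is read
    off modulo a square ([log_as_quotient]). *)

Set Implicit Arguments.
Unset Strict Implicit.
Unset Printing Implicit Defensive.

(** * Functions closed under the arithmetic operations *)

(** The closure properties shared by the functions that are values of
    arithmetic terms and those that are values of terms with HW and G_j. The
    predicate is allowed to be informative: a term for G_j can then be chosen
    for all j at once without any choice principle. *)
Record arith_closed (A : Type) (C : (A -> nat) -> Type) : Type := ArithClosed {
  closed_ext : forall f g, f =1 g -> C f -> C g;
  closed_cst : forall c, C (fun=> c);
  closed_add : forall f g, C f -> C g -> C (fun x => f x + g x);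
  closed_sub : forall f g, C f -> C g -> C (fun x => f x - g x);
  closed_div : forall f g, C f -> C g -> C (fun x => f x %/ g x);
  closed_exp : forall f g, C f -> C g -> C (fun x => f x ^ g x) }.

(** Multiplication comes from squaring: 2xy = (x + y)^2 - x^2 - y^2. *)
Lemma closed_mul A (C : (A -> nat) -> Type) (CC : arith_closed C) f g :
  C f -> C g -> C (fun x => f x * g x).
Proof.
move=> Cf Cg; apply: (closed_ext CC) (_ : C (fun x =>
  ((f x + g x) ^ 2 - f x ^ 2 - g x ^ 2) %/ 2)) => [x|].
  by rewrite sqrnD -subnDA addKn mulKn.
have CX2 h : C h -> C (fun x => h x ^ 2).
  by move=> Ch; apply: (closed_exp CC) => //; apply: (closed_cst CC).
apply: (closed_div CC); last exact: (closed_cst CC).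
by do 2![apply: (closed_sub CC); last exact: CX2]; apply/CX2/(closed_add CC).
Qed.

Lemma closed_succ A (C : (A -> nat) -> Type) (CC : arith_closed C) f :
  C f -> C (fun x => (f x).+1).
Proof.
move=> Cf; apply: (closed_ext CC) (_ : C (fun x => f x + 1)) => [x|].
  by rewrite addn1.
by apply: (closed_add CC) => //; apply: (closed_cst CC).
Qed.

Lemma closed_mod A (C : (A -> nat) -> Type) (CC : arith_closed C) f g :
  C f -> C g -> C (fun x => f x %% g x).
Proof.
move=> Cf Cg.
apply: (closed_ext CC) (_ : C (fun x => f x - f x %/ g x * g x)) => [x|].
  by rewrite {1}(divn_eq (f x) (g x)) addKn.
by apply: (closed_sub CC) => //; apply: (closed_mul CC) => //;
   apply: (closed_div CC).
Qed.

Lemma closed_sum A (C : (A -> nat) -> Type) (CC : arith_closed C) I (s : seq I)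
    (F : I -> A -> nat) :
  (forall i, C (F i)) -> C (fun x => \sum_(i <- s) F i x).
Proof.
move=> CF; elim: s => [|i s IHs].
  by apply: (closed_ext CC) (closed_cst CC 0) => x; rewrite big_nil.
by apply: (closed_ext CC) (closed_add CC (CF i) IHs) => x; rewrite big_cons.
Qed.

Lemma closed_prod A (C : (A -> nat) -> Type) (CC : arith_closed C) I
    (s : seq I) (P : pred I) (F : I -> A -> nat) :
  (forall i, C (F i)) -> C (fun x => \prod_(i <- s | P i) F i x).
Proof.
move=> CF; elim: s => [|i s IHs].
  by apply: (closed_ext CC) (closed_cst CC 1) => x; rewrite big_nil.
case Pi: (P i); last by apply: (closed_ext CC) IHs => x; rewrite big_cons Pi.
by apply: (closed_ext CC) (closed_mul CC (CF i) IHs) => x; rewrite big_cons Pi.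
Qed.

Ltac solve_closed CC :=
  repeat first
    [ assumption
    | lazymatch goal with
      | |- _ (fun _ => ?c) => apply: (closed_cst CC)
      | |- _ (fun x => @?f x + @?g x) => apply: (closed_add CC)
      | |- _ (fun x => @?f x - @?g x) => apply: (closed_sub CC)
      | |- _ (fun x => @?f x * @?g x) => apply: (closed_mul CC)
      | |- _ (fun x => @?f x %/ @?g x) => apply: (closed_div CC)
      | |- _ (fun x => @?f x %% @?g x) => apply: (closed_mod CC)
      | |- _ (fun x => @?f x ^ @?g x) => apply: (closed_exp CC)
      | |- _ (fun x => (@?f x).+1) => apply: (closed_succ CC)
      end ].

(** * Generalized geometric progressions *)

(** Summation by parts: the terms (k+1)^j q^(k+1) - k^j q^k telescope to the
    right-hand side, up to the term k = 0, and expanding (k+1)^j expresses them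
    through the progressions of kind at most j. *)
Lemma GP_rec j q t : 0 < q ->
  q.-1 * GP j q t + q * (\sum_(i < j) 'C(j, i) * GP i q t) + (j == 0)
  = t.+1 ^ j * q ^ t.+1.
Proof.
move=> q_gt0; elim: t => [|t IHt].
  have GP0 i : GP i q 0 = (i == 0).
    by rewrite /GP big_ord1 muln1; case: i => // i; rewrite exp0n.
  rewrite GP0 exp1n expn1 mul1n.
  rewrite (eq_bigr (fun i : 'I_j => (i == 0 :> nat) : nat)); last first.
    by move=> i _; rewrite GP0; case: (i : nat) => [|?]; rewrite ?bin0 ?muln0.
  case: j => [|j]; first by rewrite big_ord0; lia.
  by rewrite big_ord_recl big1 //=; lia.
have GPS i : GP i q t.+1 = GP i q t + t.+1 ^ i * q ^ t.+1.
  by rewrite /GP big_ord_recr.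
rewrite GPS (eq_bigr (fun i : 'I_j => 'C(j, i) * GP i q t
    + 'C(j, i) * t.+1 ^ i * q ^ t.+1)); last first.
  by move=> i _; rewrite GPS mulnDr mulnA.
rewrite big_split -big_distrl /=.
have bin_tS : t.+2 ^ j = \sum_(i < j) 'C(j, i) * t.+1 ^ i + t.+1 ^ j.
  rewrite -[t.+2]add1n expnDn big_ord_recr /= binn mul1n subnn mul1n.
  congr (_ + _).
  by apply: eq_bigr => i _; rewrite exp1n mul1n.
rewrite bin_tS (expnS q t.+1).
move: IHt; case: q q_gt0 {GPS bin_tS} => //= q _ IHt.
nia.
Qed.

Lemma closed_GP A (C : (A -> nat) -> Type) (CC : arith_closed C) j f g :
  C f -> C g -> (forall x, 1 < f x) -> C (fun x => GP j (f x) (g x)).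
Proof.
(* Strong induction on j, by an induction whose motive may be informative. *)
move=> Cf Cg f_gt1; elim: j.+1 {-2}j (ltnSn j) => // m IHm {}j le_jm.
apply: (closed_ext CC) (_ : C (fun x =>
  ((g x).+1 ^ j * f x ^ (g x).+1 - (j == 0)
     - f x * \sum_(i < j) 'C(j, i) * GP i (f x) (g x)) %/ (f x - 1))) => [x|].
  rewrite -(GP_rec j (g x) (ltnW (f_gt1 x))) addnK addnK -subn1 mulKn //.
  by rewrite subn_gt0.
have CG : C (fun x => \sum_(i < j) 'C(j, i) * GP i (f x) (g x)).
  apply: (closed_sum CC) => i; solve_closed CC.
  exact/IHm/(leq_trans (ltn_ord i)).
by solve_closed CC.
Qed.

(** * Binomial coefficients, gcd and logarithm *)

Lemma digit_sum N (c : nat -> nat) Z k : (forall i, c i < Z) -> k < N ->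
  (\sum_(i < N) c i * Z ^ i) %/ Z ^ k %% Z = c k.
Proof.
move=> c_lt; have Z_gt0 : 0 < Z by apply: leq_ltn_trans (c_lt 0).
elim: k N c c_lt => [|k IHk] [|N] c c_lt // lt_kN.
  all: rewrite big_ord_recl /= expn0 muln1.
  all: rewrite (eq_bigr (fun i : 'I_N => (c i.+1 * Z ^ i) * Z)); last first.
  1,3: by move=> i _; rewrite expnSr mulnA.
  all: rewrite -big_distrl /=.
  by rewrite divn1 addnC modnMDl modn_small.
rewrite expnS divnMA addnC divnMDl // (divn_small (c_lt 0)) addn0.
exact: IHk (fun i => c i.+1) _ _.
Qed.

Lemma bin_le_exp n k : 'C(n, k) <= 2 ^ n.
Proof.
have [le_kn | lt_nk] := leqP k n; last by rewrite bin_small.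
rewrite -[2]/(1 + 1) expnDn (bigD1 (Ordinal (le_kn : k < n.+1))) //=.
by rewrite !exp1n !muln1 leq_addr.
Qed.

(** The binomial coefficients C(n, k) are the digits of (1 + Z)^n in a base Z
    exceeding them all; Z = 2^(n+1) will do. *)
Lemma closed_bin A (C : (A -> nat) -> Type) (CC : arith_closed C) f g :
  C f -> C g -> (forall x, g x <= f x) -> C (fun x => 'C(f x, g x)).
Proof.
move=> Cf Cg le_gf; apply: (closed_ext CC) (_ : C (fun x =>
  (1 + 2 ^ (f x).+1) ^ f x %/ (2 ^ (f x).+1) ^ g x %% 2 ^ (f x).+1)) => [x|].
  rewrite expnDn; under eq_bigr do rewrite exp1n mul1n.
  rewrite (@digit_sum _ (fun i => 'C(f x, i))) ?ltnS // => i.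
  by apply: leq_ltn_trans (bin_le_exp _ _) _; rewrite ltn_exp2l.
by solve_closed CC.
Qed.

Lemma count_multiples d g : 0 < d -> \sum_(x < d * g) (d %| x) = g.
Proof.
move=> d_gt0; elim: g => [|g IHg]; first by rewrite muln0 big_ord0.
rewrite mulnS addnC big_split_ord /= IHg.
case: d d_gt0 {IHg} => // d _.
rewrite big_ord_recl addn0 dvdn_mulr // big1 ?addn1 // => i _.
by rewrite dvdn_addr ?dvdn_mulr // gtnNdvd // lift0 ltnS.
Qed.

(** b divides a x exactly when b / gcd(a, b) divides x. *)
Lemma count_gcd a b : 0 < b -> \sum_(x < b) (b %| a * x) = gcdn a b.
Proof.
move=> b_gt0; have g_gt0 : 0 < gcdn a b by rewrite gcdn_gt0 b_gt0 orbT.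
rewrite -[RHS](@count_multiples (b %/ gcdn a b)); last first.
  by rewrite divn_gt0 // dvdn_leq ?dvdn_gcdr.
rewrite divnK ?dvdn_gcdr //; apply: eq_bigr => x _.
rewrite -[X in X %| _](divnK (dvdn_gcdr a b)).
rewrite -[X in _ %| X * _](divnK (dvdn_gcdl a b)) mulnAC dvdn_pmul2r //.
rewrite Gauss_dvdr // /coprime -(eqn_pmul2r g_gt0) muln_gcdl.
by rewrite !divnK ?dvdn_gcdr ?dvdn_gcdl // gcdnC mul1n.
Qed.

(** Modulo Z^b - 1 the exponents a x may be reduced modulo b. The reduced sum is
    small enough to be the remainder itself, and its last digit in base Z counts
    the x < b for which b divides a x. *)
Lemma gcd_as_geometric_sum a b Z : 1 < b -> b.+1 < Z ->
  (\sum_(x < b) (Z ^ a) ^ x) %% (Z ^ b).-1 %% Z = gcdn a b.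
Proof.
move=> b_gt1 lt_bZ; have Z_gt0 : 0 < Z by lia.
have b_gt0 : 0 < b by lia.
pose N := \sum_(x < b) Z ^ (a * x %% b).
have -> : (\sum_(x < b) (Z ^ a) ^ x) %% (Z ^ b).-1 = N %% (Z ^ b).-1.
  have modZb x : Z ^ x = Z ^ (x %% b) %[mod (Z ^ b).-1].
    rewrite {1}(divn_eq x b) expnD [x %/ b * b]mulnC expnM mulnC -modnMmr.
    have -> : (Z ^ b) ^ (x %/ b) = 1 %[mod (Z ^ b).-1].
      rewrite -modnXm -{1}[Z ^ b]prednK ?expn_gt0 ?Z_gt0 //.
      by rewrite -add1n modnDr modnXm exp1n.
    by rewrite modnMmr muln1.
  rewrite /N; elim/big_rec2: _ => // i y1 y2 _ IH.
  by rewrite -modnDm IH -expnM modZb modnDm.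
(* Each of the b summands is at most Z^(b-1), and b <= Z - 2. *)
rewrite [N %% _]modn_small; last first.
  have leN : N <= b * Z ^ b.-1.
    rewrite -[b in b * _]card_ord -sum_nat_const; apply: leq_sum => x _.
    by rewrite leq_pexp2l // -ltnS prednK // ltn_pmod.
  apply: leq_ltn_trans leN _.
  have -> : Z ^ b = Z * Z ^ b.-1 by rewrite -expnS prednK.
  have : 1 < Z ^ b.-1 by rewrite -(expn0 Z) ltn_exp2l; lia.
  nia.
rewrite -(count_gcd a b_gt0) -[RHS](@modn_small _ Z); last first.
  rewrite count_gcd // (leq_ltn_trans _ (ltnW lt_bZ)) //.
  exact: dvdn_leq b_gt0 (dvdn_gcdr a b).
rewrite /N; elim/big_rec2: _ => // x y1 y2 _ IH; rewrite -modnDm IH modnDm.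
rewrite -modnDml -[RHS]modnDml; congr ((_ + _) %% _); rewrite /dvdn.
by case: (a * x %% b) => // i; rewrite expnS modnMr mod0n.
Qed.

(** With M = 2^K - 1, the binomial expansion of (1 + M)^v is 1 + v M
    modulo M^2. *)
Lemma log_as_quotient v K : 1 < K -> v < (2 ^ K).-1 ->
  ((2 ^ v) ^ K %% (2 ^ K).-1 ^ 2) %/ (2 ^ K).-1 = v.
Proof.
move=> K_gt1; set M := (2 ^ K).-1 => lt_vM.
have M_gt2 : 2 < M by rewrite -ltnS prednK ?expn_gt0 // (@leq_exp2l 2 2).
have -> : (2 ^ v) ^ K = 1 + v * M %[mod M ^ 2].
  rewrite expnAC -[2 ^ K]prednK ?expn_gt0 // -/M.
  elim: v {lt_vM} => // v IHv.
  rewrite expnSr -modnMml IHv modnMml.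
  have -> : (1 + v * M) * M.+1 = v * M ^ 2 + (1 + v.+1 * M) by ring.
  by rewrite modnMDl.
rewrite modn_small ?divnMDr // 1?addnC; last nia.
by rewrite divnMDl ?divn_small ?addn0 //; lia.
Qed.

(** * The Hamming weight *)

(** The number of digits inspected may be any bound on the length. *)
Lemma HW_digits N n : n < 2 ^ N -> HW n = \sum_(i < N) odd (n %/ 2 ^ i).
Proof.
have tail a b : a <= b -> n < 2 ^ a ->
    \sum_(i < b) odd (n %/ 2 ^ i) = \sum_(i < a) odd (n %/ 2 ^ i).
  move=> le_ab lt_na; rewrite -(subnKC le_ab) big_split_ord /= [X in _ + X]big1.
    by rewrite addn0.
  move=> i _; rewrite divn_small // (leq_trans lt_na) //.
  by rewrite leq_exp2l // leq_addr.
have lt_n := ltn_expl n (isT : 1 < 2).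
by move=> lt_nN; rewrite /HW; case/orP: (leq_total n N) => /tail->.
Qed.

Lemma HW0 : HW 0 = 0. Proof. exact: big_ord0. Qed.

Lemma HW_rec n : HW n = odd n + HW n./2.
Proof.
have lt_n := ltn_expl n (isT : 1 < 2).
rewrite (@HW_digits n.+1) ?big_ord_recl ?divn1; last by rewrite expnS; lia.
rewrite (@HW_digits n n./2); last by lia.
by congr (_ + _); apply: eq_bigr => i _; rewrite expnS divnMA divn2.
Qed.

Lemma HW_double n : HW n.*2 = HW n.
Proof. by rewrite HW_rec odd_double doubleK. Qed.

Lemma HW_le n : HW n <= n.
Proof.
rewrite -[leqRHS]card_ord -sum1_card; apply: leq_sum => i _; exact: leq_b1.
Qed.

(** Legendre: the exponent of 2 in n! is n - HW(n). Each quotient n / 2^i is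
    its parity plus twice the next one, so the sums telescope. *)
Lemma logn_fact_HW n : logn 2 n`! + HW n = n.
Proof.
suff tele N : \sum_(i < N) odd (n %/ 2 ^ i) + \sum_(i < N) n %/ 2 ^ i.+1
    + n %/ 2 ^ N = n.
  have := tele n; rewrite (divn_small (ltn_expl n (isT : 1 < 2))) addn0.
  by rewrite logn_fact // big_add1 big_mkord /= addnC.
elim: N => [|N IHN]; first by rewrite !big_ord0 divn1.
rewrite -[RHS]IHN !big_ord_recr /= expnSr divnMA divn2.
have := odd_double_half (n %/ 2 ^ N); lia.
Qed.

Lemma logn_central_bin n : logn 2 'C(n.*2, n) = HW n.
Proof.
have := congr1 (logn 2) (bin_fact (leq_addr n n)).
rewrite addnK addnn !lognM ?muln_gt0 ?fact_gt0 ?bin_gt0 -?addnn ?leq_addr //.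
have := logn_fact_HW n; have := logn_fact_HW n.*2.
by rewrite HW_double -addnn; lia.
Qed.

(** The exponent n + 1 is at least HW(n), so that the whole 2-part of the
    central binomial coefficient is kept. *)
Lemma exp_HW_gcd n : gcdn 'C(n.*2, n) (2 ^ n.+1) = 2 ^ HW n.
Proof.
have C_gt0 : 0 < 'C(n.*2, n) by rewrite bin_gt0 -addnn leq_addr.
have [o co_o ->] := pfactor_coprime (isT : prime 2) C_gt0.
rewrite logn_central_bin -(subnK (leqW (HW_le n))) expnD -muln_gcdl.
by rewrite (eqP (coprimeXr _ _)) ?mul1n // coprime_sym.
Qed.

Lemma closed_HW A (C : (A -> nat) -> Type) (CC : arith_closed C) f :
  C f -> C (fun x => HW (f x)).
Proof.
move=> Cf.
(* The gcd formula with a = C(2n, n), b = 2^(n+1) and Z = b + 2. *)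
have Cgcd : C (fun x => 2 ^ HW (f x)).
  apply: (closed_ext CC) (_ : C (fun x =>
    GP 0 ((2 ^ (f x).+1 + 2) ^ 'C(2 * f x, f x)) (2 ^ (f x).+1 - 1)
      %% ((2 ^ (f x).+1 + 2) ^ 2 ^ (f x).+1 - 1)
      %% (2 ^ (f x).+1 + 2))) => [x|].
    rewrite -exp_HW_gcd -(@gcd_as_geometric_sum _ _ (2 ^ (f x).+1 + 2));
      last 2 first.
    - by rewrite -{1}(expn0 2) ltn_exp2l.
    - by rewrite addn2.
    rewrite /GP subn1 prednK ?expn_gt0 // mul2n subn1.
    by congr (_ %% _ %% _); apply: eq_bigr => i _; rewrite mul1n.
  apply: (closed_mod CC); last by solve_closed CC.
  apply: (closed_mod CC); last by solve_closed CC.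
  apply: (closed_GP CC) => [||x].
  - apply: (closed_exp CC); first by solve_closed CC.
    apply: (closed_bin CC) => // [|x]; first by solve_closed CC.
    by rewrite leq_pmull.
  - by solve_closed CC.
  rewrite -(expn0 (2 ^ (f x).+1 + 2)) ltn_exp2l ?addn2 // bin_gt0.
  by rewrite leq_pmull.
(* K = n + 2 makes 2^K - 1 larger than HW(n). *)
apply: (closed_ext CC) (_ : C (fun x =>
  ((2 ^ HW (f x)) ^ (f x).+2 %% (2 ^ (f x).+2 - 1) ^ 2)
    %/ (2 ^ (f x).+2 - 1))) => [x|].
  rewrite subn1 log_as_quotient // (leq_ltn_trans (HW_le _)) //.
  by have := ltn_expl (f x) (isT : 1 < 2); rewrite !expnS; lia.
by solve_closed CC.
Qed.

(** * Counting nonzero digits by the Hamming weight *)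

Lemma HW_add L x y : x < 2 ^ L -> HW (x + 2 ^ L * y) = HW x + HW y.
Proof.
elim: L x => [|L IHL] x lt_x.
  by move: lt_x; rewrite expn0 ltnS leqn0 => /eqP->; rewrite HW0 mul1n.
rewrite expnS -mulnA mul2n HW_rec oddD odd_double addbF halfD odd_double andbF.
rewrite add0n doubleK IHL; last by move: lt_x; rewrite expnS; lia.
by rewrite [HW x]HW_rec addnA.
Qed.

Lemma HW_complement u c : c < 2 ^ u -> HW ((2 ^ u).-1 - c) + HW c = u.
Proof.
elim: u c => [|u IHu] c lt_c.
  by move: lt_c; rewrite expn0 ltnS leqn0 => /eqP->; rewrite HW0.
rewrite HW_rec [HW c]HW_rec.
have lt_c2 : c./2 < 2 ^ u by move: lt_c; rewrite expnS; lia.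
have -> : ((2 ^ u.+1).-1 - c)./2 = (2 ^ u).-1 - c./2.
  by move: lt_c; rewrite expnS; lia.
have -> : odd ((2 ^ u.+1).-1 - c) = ~~ odd c.
  rewrite oddB; last by lia.
  by rewrite -subn1 oddB ?expn_gt0 // oddX.
by have := IHu _ lt_c2; case: (odd c); lia.
Qed.

(** The product (2^u - 1) d equals (d - 1) 2^u + (2^u - 1 - (d - 1)): its high
    half is d - 1 and its low half the u-bit complement of d - 1. *)
Lemma HW_mul_ones u d : 0 < d <= 2 ^ u -> HW ((2 ^ u).-1 * d) = u.
Proof.
case: d => // d /= lt_d.
have -> : (2 ^ u).-1 * d.+1 = (2 ^ u).-1 - d + 2 ^ u * d by nia.
by rewrite HW_add ?HW_complement //; lia.
Qed.

Lemma HW_count_nonzero_digits u N (d : 'I_N -> nat) : 0 < u ->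
  (forall i, d i <= 2 ^ u) ->
  HW ((2 ^ u).-1 * \sum_(i < N) d i * (2 ^ (2 * u)) ^ i)
    = u * \sum_(i < N) (d i != 0).
Proof.
move=> u_gt0; elim: N d => [|N IHN] d le_d.
  by rewrite !big_ord0 !muln0 HW0.
rewrite !big_ord_recl /= muln1 mulnDr.
rewrite (eq_bigr (fun i : 'I_N =>
    2 ^ (2 * u) * (d (lift ord0 i) * (2 ^ (2 * u)) ^ i))); last first.
  by move=> i _; rewrite expnS mulnCA.
rewrite -big_distrr /= mulnCA HW_add; last first.
  rewrite mul2n -addnn expnD.
  by have := le_d ord0; have := expn_gt0 2 u; nia.
rewrite (IHN (fun i => d (lift ord0 i))) // mulnDr; congr (_ + _).
have [-> | nz_d] := eqVneq (d ord0) 0; first by rewrite !muln0 HW0.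
by rewrite muln1 HW_mul_ones // lt0n nz_d le_d.
Qed.

(** * Exponential polynomials and systems of equations *)

(** Exponential polynomials in parameters, indexed by 'I_r, and unknowns,
    indexed by X. The exponential is applied to single unknowns only, so that
    an expression is a sum of monomials; other exponents are named by an
    additional unknown. *)
Inductive expoly (r : nat) (X : Type) : Type :=
| EPar of 'I_r
| EVar of X
| ECst of nat
| EAdd of expoly r X & expoly r X
| EMul of expoly r X & expoly r X
| EExp2 of X.

Arguments EPar {r X}.
Arguments EVar {r X}.
Arguments ECst {r X}.
Arguments EExp2 {r X}.

Fixpoint peval r X (E : expoly r X) (n : r.-tuple nat) (e : X -> nat) : nat :=
  match E with
  | EPar i => tnth n i
  | EVar x => e x
  | ECst c => c
  | EAdd E1 E2 => peval E1 n e + peval E2 n e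
  | EMul E1 E2 => peval E1 n e * peval E2 n e
  | EExp2 x => 2 ^ e x
  end.

Fixpoint prename r X Z (s : X -> Z) (E : expoly r X) : expoly r Z :=
  match E with
  | EPar i => EPar i
  | EVar x => EVar (s x)
  | ECst c => ECst c
  | EAdd E1 E2 => EAdd (prename s E1) (prename s E2)
  | EMul E1 E2 => EMul (prename s E1) (prename s E2)
  | EExp2 x => EExp2 (s x)
  end.

Lemma peval_rename r X Z (s : X -> Z) (E : expoly r X) n e :
  peval (prename s E) n e = peval E n (e \o s).
Proof. by elim: E => //= E1 -> E2 ->. Qed.

Lemma peval_ext r X (E : expoly r X) n e1 e2 :
  e1 =1 e2 -> peval E n e1 = peval E n e2.
Proof.
by move=> e12; elim: E => //= [E1 -> E2 -> | E1 -> E2 -> | x] //; rewrite e12.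
Qed.

Lemma peval_le r X (E : expoly r X) n e1 e2 :
  (forall x, e1 x <= e2 x) -> peval E n e1 <= peval E n e2.
Proof.
move=> e12; elim: E => //= [E1 le1 E2 le2 | E1 le1 E2 le2 | x].
- exact: leq_add.
- exact: leq_mul.
- by rewrite leq_exp2l.
Qed.

Definition system r X := seq (expoly r X * expoly r X).

Definition holds r X (L : system r X) n e : bool :=
  all (fun p => peval p.1 n e == peval p.2 n e) L.

Definition srename r X Z (s : X -> Z) (L : system r X) : system r Z :=
  [seq (prename s p.1, prename s p.2) | p <- L].

Lemma holds_rename r X Z (s : X -> Z) (L : system r X) n e :
  holds (srename s L) n e = holds L n (e \o s).
Proof.
by rewrite /holds all_map; apply: eq_all => p /=; rewrite !peval_rename.
Qed.

Lemma holds_ext r X (L : system r X) n e1 e2 :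
  e1 =1 e2 -> holds L n e1 = holds L n e2.
Proof.
by move=> e12; apply: eq_all => p; rewrite !(peval_ext _ _ e12).
Qed.

(** * Functions defined by systems with unique bounded solutions *)

(** A class of bounds stable under composition and dominating all arithmetic
    operations. *)
Definition tower d s := iter d (expn 2) s.

Lemma le_tower d s : s <= tower d s.
Proof. by elim: d => //= d IHd; apply: leq_trans IHd (ltnW (ltn_expl _ _)). Qed.

Lemma towerD d1 d2 s : tower d1 (tower d2 s) = tower (d1 + d2) s.
Proof. by rewrite /tower iterD. Qed.

Lemma tower_le_depth d1 d2 s : d1 <= d2 -> tower d1 s <= tower d2 s.
Proof. by move=> /subnK<-; rewrite -towerD le_tower. Qed.

Definition env2 X Y (e : X -> nat) (w : Y -> nat) (z : X + Y) : nat :=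
  match z with inl x => e x | inr y => w y end.

(** The function f is the value of V at the unique solution W of a system in
    auxiliary unknowns Y. Both f and W are bounded by a tower in any bound on
    the arguments. *)
Definition definable r (X : Type) (f : r.-tuple nat -> (X -> nat) -> nat) :
    Prop :=
  exists (Y : finType) (L : system r (X + Y)) (V : expoly r (X + Y))
         (W : r.-tuple nat -> (X -> nat) -> Y -> nat) (d : nat),
  [/\ forall n e w, holds L n (env2 e w) <-> w =1 W n e,
      forall n e, peval V n (env2 e (W n e)) = f n e
    & forall n e s, (forall i, tnth n i <= s) -> (forall x, e x <= s) ->
        f n e <= tower d s /\ forall y, W n e y <= tower d s].

Lemma definable_simple r X (V : expoly r (X + void)) f d :
  (forall n e w, peval V n (env2 e w) = f n e) ->
  (forall n e s, (forall i, tnth n i <= s) -> (forall x, e x <= s) ->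
     f n e <= tower d s) ->
  definable f.
Proof.
move=> Vf le_f; exists void, [::], V, (fun _ _ => of_void _), d.
split=> [n e w|//|n e s le_n le_e]; first by split=> // _ [].
by split=> [|[]]; apply: le_f.
Qed.

Lemma definable_ext r X (f g : r.-tuple nat -> (X -> nat) -> nat) :
  (forall n e, f n e = g n e) -> definable f -> definable g.
Proof.
move=> fg [Y [L [V [W [d [LW VW le_d]]]]]]; exists Y, L, V, W, d.
by split=> [//|n e|n e s]; rewrite -fg; [apply: VW | apply: le_d].
Qed.

(** One operation h applied to two definable functions. The new unknowns Y',
    with values H, are pinned down by the equations Q, in which the two operands
    occur as arbitrary expressions; U reads off the result. The two systems for
    the operands are put side by side. *)
Lemma definable_extend r X (Y' : finType) (h : nat -> nat -> nat)
    (H : nat -> nat -> Y' -> nat)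
    (Q : forall Z, expoly r Z -> expoly r Z -> (Y' -> Z) -> system r Z)
    (U : forall Z, expoly r Z -> expoly r Z -> (Y' -> Z) -> expoly r Z)
    (c : nat) (f g : r.-tuple nat -> (X -> nat) -> nat) :
  (forall Z n (e : Z -> nat) a b v, holds (Q Z a b v) n e <->
     forall y, e (v y) = H (peval a n e) (peval b n e) y) ->
  (forall Z n (e : Z -> nat) a b v,
     (forall y, e (v y) = H (peval a n e) (peval b n e) y) ->
     peval (U Z a b v) n e = h (peval a n e) (peval b n e)) ->
  (forall a b s, a <= s -> b <= s ->
     h a b <= tower c s /\ forall y, H a b y <= s) ->
  definable f -> definable g -> definable (fun n e => h (f n e) (g n e)).
Proof.
move=> QH Uh le_h [Y1 [L1 [V1 [W1 [d1 [LW1 VW1 le_d1]]]]]].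
move=> [Y2 [L2 [V2 [W2 [d2 [LW2 VW2 le_d2]]]]]].
pose i1 (z : X + Y1) : X + (Y1 + Y2 + Y') :=
  match z with inl x => inl x | inr y => inr (inl (inl y)) end.
pose i2 (z : X + Y2) : X + (Y1 + Y2 + Y') :=
  match z with inl x => inl x | inr y => inr (inl (inr y)) end.
pose i3 y : X + (Y1 + Y2 + Y') := inr (inr y).
pose a := prename i1 V1; pose b := prename i2 V2.
pose W n e (y : Y1 + Y2 + Y') := match y with
  | inl (inl y1) => W1 n e y1
  | inl (inr y2) => W2 n e y2
  | inr y' => H (f n e) (g n e) y'
  end.
exists (Y1 + Y2 + Y')%type, (srename i1 L1 ++ srename i2 L2 ++ Q _ a b i3),
  (U _ a b i3), W, (c + (d1 + d2)).
have ea n e w : w \o inl \o inl =1 W1 n e -> peval a n (env2 e w) = f n e.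
  move=> w1; rewrite /a peval_rename -VW1; apply: peval_ext => -[x|y] //=.
  exact: w1.
have eb n e w : w \o inl \o inr =1 W2 n e -> peval b n (env2 e w) = g n e.
  move=> w2; rewrite /b peval_rename -VW2; apply: peval_ext => -[x|y] //=.
  exact: w2.
split=> [n e w|n e|n e s le_n le_e].
- rewrite /holds !all_cat -!/(holds _ _ _) !holds_rename.
  rewrite (holds_ext _ _ (_ : _ \o i1 =1 env2 e (w \o inl \o inl)));
    last by case.
  rewrite (holds_ext _ _ (_ : _ \o i2 =1 env2 e (w \o inl \o inr)));
    last by case.
  split=> [/and3P[/LW1 w1 /LW2 w2 /QH w3] [[y|y]|y] | w_eq].
  + exact: w1.
  + exact: w2.
  + by have /= := w3 y; rewrite ea ?eb.
  have w1 : w \o inl \o inl =1 W1 n e by move=> y; apply: (w_eq (inl (inl y))).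
  have w2 : w \o inl \o inr =1 W2 n e by move=> y; apply: (w_eq (inl (inr y))).
  apply/and3P; split; [exact/LW1 | exact/LW2 | apply/QH => y /=].
  by rewrite ea ?eb // w_eq.
- by rewrite Uh ?ea ?eb // => y; rewrite ea ?eb.
have [le_f le_W1] := le_d1 n e s le_n le_e.
have [le_g le_W2] := le_d2 n e s le_n le_e.
have up1 m : m <= tower d1 s -> m <= tower (d1 + d2) s.
  by move=> le_m; rewrite (leq_trans le_m) ?tower_le_depth ?leq_addr.
have up2 m : m <= tower d2 s -> m <= tower (d1 + d2) s.
  by move=> le_m; rewrite (leq_trans le_m) ?tower_le_depth ?leq_addl.
have [le_hs le_Hs] := le_h _ _ _ (up1 _ le_f) (up2 _ le_g).
rewrite -towerD; split=> // -[[y|y]|y] /=; apply: leq_trans (le_tower c _).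
- exact: up1.
- exact: up2.
- exact: le_Hs.
Qed.

Lemma definable_par r X i :
  definable (fun (n : r.-tuple nat) (_ : X -> nat) => tnth n i).
Proof. exact: (@definable_simple r X (EPar i) _ 0). Qed.

Lemma definable_var r X x :
  definable (fun (_ : r.-tuple nat) (e : X -> nat) => e x).
Proof. exact: (@definable_simple r X (EVar (inl x)) _ 0). Qed.

Lemma definable_cst r X c :
  definable (fun (_ : r.-tuple nat) (_ : X -> nat) => c).
Proof.
apply: (@definable_simple r X (ECst c) _ c) => // _ _ s _ _.
elim: c => //= c IHc; apply: leq_ltn_trans IHc (ltn_expl _ _) => //.
Qed.

Lemma double_le_exp s : s + s <= 2 ^ s.
Proof.
by case: s => // s; have := ltn_expl s (isT : 1 < 2); rewrite expnS; lia.
Qed.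

Lemma definable_add r X (f g : r.-tuple nat -> (X -> nat) -> nat) :
  definable f -> definable g -> definable (fun n e => f n e + g n e).
Proof.
apply: (@definable_extend r X void addn (fun _ _ => of_void _)
  (fun _ _ _ _ => [::]) (fun _ a b _ => EAdd a b) 1) => //.
by move=> a b s le_a le_b; split=> [|[]] //=; have := double_le_exp s; lia.
Qed.

Lemma definable_mul r X (f g : r.-tuple nat -> (X -> nat) -> nat) :
  definable f -> definable g -> definable (fun n e => f n e * g n e).
Proof.
apply: (@definable_extend r X void muln (fun _ _ => of_void _)
  (fun _ _ _ _ => [::]) (fun _ a b _ => EMul a b) 2) => //.
move=> a b s le_a le_b; split=> [|[]] //=.
apply: leq_trans (_ : 2 ^ (s + s) <= _); last first.
  by rewrite leq_exp2l ?double_le_exp.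
by rewrite expnD leq_mul // ltnW // (leq_ltn_trans _ (ltn_expl s _)).
Qed.

Lemma definable_exp2 r X (f : r.-tuple nat -> (X -> nat) -> nat) :
  definable f -> definable (fun n e => 2 ^ f n e).
Proof.
move=> def_f.
apply: (@definable_extend r X unit (fun a _ => 2 ^ a) (fun a _ _ => a)
  (fun _ a _ v => [:: (EVar (v tt), a)]) (fun _ _ _ v => EExp2 (v tt)) 1
  f f _ _ _ def_f def_f) => [Z n e a b v|Z n e a b v /= -> //|a b s le_a _].
  rewrite /holds /= andbT; split=> [/eqP ev [] // | ev]; exact/eqP.
by split=> //=; rewrite leq_exp2l.
Qed.

Lemma definable_sub r X (f g : r.-tuple nat -> (X -> nat) -> nat) :
  definable f -> definable g -> definable (fun n e => f n e - g n e).
Proof.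
apply: (@definable_extend r X bool subn
  (fun a b y => if y then a - b else b - a)
  (fun _ a b v => [:: (EAdd a (EVar (v false)), EAdd b (EVar (v true)));
                      (EMul (EVar (v true)) (EVar (v false)), ECst 0)])
  (fun _ _ _ v => EVar (v true)) 0) => [Z n e a b v|Z n e a b v /= -> //|a b s].
  rewrite /holds /= andbT; split=> [/andP[/eqP e1]|ev].
    by rewrite muln_eq0 => /orP[] /eqP e2 []; lia.
  by rewrite !ev; apply/andP; split; apply/eqP; nia.
by move=> le_a le_b; split=> [|[]] /=; lia.
Qed.

(** The second equation says that b = w + v + 1, hence w < b, unless
    b = z = v = 0: this exceptional case is division by zero, where the quotient
    is 0 and the remainder a. *)
Lemma quotient_system a b z w v :
  a = b * z + w /\ (w + v).+1 * (b + (z + v)) = b * (b + (z + v)) <->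
  [/\ z = a %/ b, w = a %% b & v = b - (a %% b).+1].
Proof.
have [->|b_gt0] := posnP b.
  rewrite divn0 modn0; split=> [[]|[-> -> ->]]; last by split; lia.
  by rewrite !mul0n !add0n => -> /eqP; rewrite muln_eq0 /=; split; lia.
split=> [[-> /eqP]|[-> -> ->]].
  rewrite eqn_mul2r addn_eq0 (gtn_eqF b_gt0) /= => /eqP e_b.
  have lt_wb : w < b by rewrite -e_b ltnS leq_addr.
  by rewrite mulnC divnMDl // modnMDl divn_small ?modn_small //; split; lia.
split; first by rewrite mulnC -divn_eq.
by congr (_ * _); rewrite -addSn subnKC ?ltn_pmod.
Qed.

Lemma definable_div r X (f g : r.-tuple nat -> (X -> nat) -> nat) :
  definable f -> definable g -> definable (fun n e => f n e %/ g n e).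
Proof.
apply: (@definable_extend r X (option bool) divn
  (fun a b y => match y with
     | None => a %/ b
     | Some true => a %% b
     | Some false => b - (a %% b).+1
     end)
  (fun _ a b x =>
     let z := EVar (x None) in
     let w := EVar (x (Some true)) in
     let v := EVar (x (Some false)) in
     let S := EAdd b (EAdd z v) in
     [:: (a, EAdd (EMul b z) w);
         (EMul (EAdd (EAdd w v) (ECst 1)) S, EMul b S)])
  (fun _ _ _ x => EVar (x None)) 0) => [Z n e a b x|Z n e a b x /= -> //|a b s].
  rewrite /holds /= andbT addn1; split=> [/andP[/eqP e1 /eqP e2]|ex].
    by have [? ? ?] := (quotient_system _ _ _ _ _).1 (conj e1 e2); case=> [[]|].
  by apply/andP; rewrite -!(rwP eqP); apply/quotient_system; rewrite !ex.
move=> le_a le_b; have le_q := leq_div a b; have le_m := leq_mod a b.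
by split=> [|[[]|]] /=; lia.
Qed.

(** Modulo D = 2^m - x the number 2^m is x, hence x^y is the remainder of
    2^(m y) once D exceeds x^y; m = x y + x + 1 is large enough. *)
Lemma definable_exp r X (f g : r.-tuple nat -> (X -> nat) -> nat) :
  definable f -> definable g -> definable (fun n e => f n e ^ g n e).
Proof.
move=> def_f def_g.
pose m n e := f n e * g n e + f n e + 1.
have def_m : definable m.
  by apply/definable_add/definable_cst/definable_add/def_f/definable_mul.
pose D n e := 2 ^ m n e - f n e.
have def_D : definable D by apply/definable_sub/def_f/definable_exp2.
pose p n e := 2 ^ (m n e * g n e).
have def_p : definable p by apply/definable_exp2/definable_mul.
apply: (@definable_ext _ _ (fun n e => p n e - p n e %/ D n e * D n e)).
  move=> n e; rewrite {1}(divn_eq (p n e) (D n e)) addKn /p /D /m.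
  move: (f n e) (g n e) => x y {m D p def_m def_D def_p}.
  have lt_x : x < 2 ^ x by apply: ltn_expl.
  have le_xy : x ^ y <= 2 ^ (x * y).
    by rewrite expnM; case: y => // y; rewrite leq_exp2r // ltnW.
  have Exy : 2 ^ (x * y + x + 1) = 2 * (2 ^ (x * y) * 2 ^ x).
    by rewrite addn1 expnS expnD.
  have le_D : x ^ y + x < 2 ^ (x * y + x + 1).
    by rewrite Exy; have := expn_gt0 2 (x * y); nia.
  rewrite expnM -modnXm -{1}(subnK (_ : x <= 2 ^ (x * y + x + 1))); last by lia.
  by rewrite modnDl modnXm modn_small //; lia.
by apply/definable_sub/definable_mul/def_D/definable_div.
Qed.

Lemma definable_aterm r k (T : aterm (r + k)) :
  definable (fun (n : r.-tuple nat) (e : 'I_k -> nat) =>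
               aeval T (cat_tuple n (mktuple e))).
Proof.
elim: T => /= [i|c|T1 d1 T2 d2|T1 d1 T2 d2|T1 d1 T2 d2|T1 d1 T2 d2].
- case: (split_ordP i) => j ->.
    by apply: definable_ext (definable_par _ j) => n e; rewrite tnth_lshift.
  apply: definable_ext (definable_var _ j) => n e.
  by rewrite tnth_rshift tnth_mktuple.
- exact: definable_cst.
- exact: definable_add.
- exact: definable_sub.
- exact: definable_div.
- exact: definable_exp.
Qed.

(** * Expansion into monomials *)

(** A monomial: a coefficient depending on the parameters only, and for each
    unknown x the exponents alpha and beta of a factor x^alpha (2^beta)^x. *)
Definition mono r (X : Type) : Type :=
  (expoly r void * (X -> nat) * (X -> nat))%type.

Definition mono_eval r (X : finType) (m : mono r X) n (e : X -> nat) : nat :=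
  peval m.1.1 n (of_void _) * \prod_x (e x ^ m.1.2 x * (2 ^ m.2 x) ^ e x).

Definition mono_mul r X (m1 m2 : mono r X) : mono r X :=
  (EMul m1.1.1 m2.1.1, fun x => m1.1.2 x + m2.1.2 x, fun x => m1.2 x + m2.2 x).

Fixpoint monos r (X : finType) (E : expoly r X) : seq (mono r X) :=
  match E with
  | EPar i => [:: (EPar i, fun=> 0, fun=> 0)]
  | EVar x => [:: (ECst 1, fun y => y == x : nat, fun=> 0)]
  | ECst c => [:: (ECst c, fun=> 0, fun=> 0)]
  | EAdd E1 E2 => monos E1 ++ monos E2
  | EMul E1 E2 => [seq mono_mul m1 m2 | m1 <- monos E1, m2 <- monos E2]
  | EExp2 x => [:: (ECst 1, fun=> 0, fun y => y == x : nat)]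
  end.

Lemma mono_evalM r (X : finType) (m1 m2 : mono r X) n e :
  mono_eval (mono_mul m1 m2) n e = mono_eval m1 n e * mono_eval m2 n e.
Proof.
rewrite /mono_eval /= mulnACA -big_split; congr (_ * _).
by apply: eq_bigr => x _; rewrite !expnD expnMn mulnACA.
Qed.

Lemma sum_monos r (X : finType) (E : expoly r X) n e :
  \sum_(m <- monos E) mono_eval m n e = peval E n e.
Proof.
have prod1 c :
    peval c n (of_void nat) * (\prod_(x : X) (e x ^ 0 * (2 ^ 0) ^ e x))
    = peval c n (of_void nat).
  by rewrite big1 ?muln1 // => x _; rewrite exp1n.
elim: E => [i|x|c|E1 IH1 E2 IH2|E1 IH1 E2 IH2|x] /=.
- by rewrite big_seq1 /mono_eval prod1.
- rewrite big_seq1 /mono_eval /= mul1n (bigD1 x) //= eqxx exp1n big1 ?muln1 //.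
  by move=> y /negPf->; rewrite exp1n.
- by rewrite big_seq1 /mono_eval prod1.
- by rewrite -IH1 -IH2 big_cat.
- rewrite -IH1 -IH2 big_allpairs_dep /= big_distrlr /=.
  by under eq_bigr do under eq_bigr do rewrite mono_evalM.
- rewrite big_seq1 /mono_eval /= mul1n (bigD1 x) //= eqxx mul1n big1 ?muln1 //.
  by move=> y /negPf->; rewrite exp1n.
Qed.

(** Even the zero polynomial is expanded into at least one monomial, so that
    the term summing it over a box always involves some G_j. *)
Lemma monos_neq_nil r (X : finType) (E : expoly r X) : 0 < size (monos E).
Proof.
elim: E => //= [E1 s1 E2 s2|E1 s1 E2 s2]; first by rewrite size_cat addn_gt0 s1.
by rewrite size_allpairs muln_gt0 s1.
Qed.

(** * Numbering the points of a box *)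

Definition box_index (X : finType) B (c : {ffun X -> 'I_B}) : nat :=
  \sum_x c x * B ^ enum_rank x.

Lemma base_expansion_lt B N (a : 'I_N -> nat) :
  (forall i, a i < B) -> \sum_(i < N) a i * B ^ i < B ^ N.
Proof.
elim: N a => [|N IHN] a lt_a; first by rewrite big_ord0.
rewrite big_ord_recr /= expnS.
have /= := IHN (fun i => a (widen_ord (leqnSn N) i)) (fun i => lt_a _).
have := lt_a ord_max; nia.
Qed.

Lemma base_expansion_inj B N (a1 a2 : 'I_N -> nat) :
  (forall i, a1 i < B) -> (forall i, a2 i < B) ->
  \sum_(i < N) a1 i * B ^ i = \sum_(i < N) a2 i * B ^ i -> a1 =1 a2.
Proof.
elim: N a1 a2 => [|N IHN] a1 a2 lt1 lt2; first by move=> _ [].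
rewrite !big_ord_recr /= => e12.
pose w := widen_ord (leqnSn N).
have b1 := base_expansion_lt (fun i => lt1 (w i)).
have b2 := base_expansion_lt (fun i => lt2 (w i)).
have e_max : a1 ord_max = a2 ord_max.
  move/(congr1 (divn^~ (B ^ N))): e12; rewrite addnC [in RHS]addnC.
  by rewrite !divnMDl ?(divn_small b1) ?(divn_small b2); lia.
move: e12; rewrite e_max => /addIn e12 i.
case: (unliftP ord_max i) => [j ->|->] //.
have -> : lift ord_max j = w j.
  by apply: val_inj; rewrite /= /bump leqNgt ltn_ord.
exact: (IHN (a1 \o w) (a2 \o w) (fun i => lt1 _) (fun i => lt2 _) e12 j).
Qed.

Lemma box_index_enum (X : finType) B (c : {ffun X -> 'I_B}) :
  box_index c = \sum_(i < #|X|) c (enum_val i) * B ^ i.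
Proof.
rewrite /box_index (reindex_onto (@enum_val X X) enum_rank) /=; last first.
  by move=> x _; rewrite enum_rankK.
apply: eq_big => [i|i _]; by rewrite enum_valK ?eqxx.
Qed.

Lemma box_index_lt (X : finType) B (c : {ffun X -> 'I_B}) :
  box_index c < B ^ #|X|.
Proof.
by rewrite box_index_enum (@base_expansion_lt _ _ (fun i => c (enum_val i))).
Qed.

Lemma box_index_inj (X : finType) B : injective (@box_index X B).
Proof.
move=> c1 c2; rewrite !box_index_enum => e12; apply/ffunP => x; apply: val_inj.
by have := @base_expansion_inj _ _ (fun i => c1 (enum_val i))
     (fun i => c2 (enum_val i)) _ _ e12 (enum_rank x);
   rewrite enum_rankK; apply.
Qed.

(** The positional numbering of the box reduces this to digits of a single
    number. *)
Lemma HW_count_nonzero_box (X : finType) B u (d : {ffun X -> 'I_B} -> nat) :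
  0 < u -> (forall c, d c <= 2 ^ u) ->
  HW ((2 ^ u).-1 * \sum_c d c * (2 ^ (2 * u)) ^ box_index c)
    = u * #|[set c | d c != 0]|.
Proof.
move=> u_gt0 le_d.
pose h c := Ordinal (box_index_lt c) : 'I_(B ^ #|X|).
have h_inj : injective h by move=> c1 c2 [/box_index_inj].
have [g gK hK] : bijective h.
  by apply: (inj_card_bij h_inj); rewrite card_ffun !card_ord.
have g_bij : bijective g by exists h.
rewrite (reindex g) /=; last exact: onW_bij.
under eq_bigr => i _ do rewrite -[box_index _]/(val (h (g i))) hK.
rewrite (HW_count_nonzero_digits u_gt0 (fun i => le_d (g i))); congr (_ * _).
rewrite -[RHS]sum1_card [RHS](reindex g); last exact: onW_bij.
by rewrite [RHS]big_mkcond; apply: eq_bigr => i _ /=; rewrite inE; case: eqP.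
Qed.

(** * Summation over a box *)

Definition hrep r (f : r.-tuple nat -> nat) : Prop :=
  exists E : hgterm r, admissible E /\ forall n, heval E n = f n.

(** Keeps track of an occurrence of some G_j in the term. *)
Definition hrepG r (f : r.-tuple nat -> nat) : Prop :=
  exists E : hgterm r,
    [/\ admissible E, uses_GP E & forall n, heval E n = f n].

Lemma hrep_closed r : arith_closed (@hrep r).
Proof.
split=> [f g fg [E [aE eE]]|c|f g|f g|f g|f g].
- by exists E; split=> // n; rewrite eE.
- by exists (HCst r c).
all: move=> [E1 [a1 e1]] [E2 [a2 e2]].
- by exists (HAdd E1 E2); split=> //= n; rewrite e1 e2.
- by exists (HMonus E1 E2); split=> //= n; rewrite e1 e2.
- by exists (HQuo E1 E2); split=> //= n; rewrite e1 e2.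
- by exists (HPow E1 E2); split=> //= n; rewrite e1 e2.
Qed.

Lemma hrep_var r i : hrep (fun n : r.-tuple nat => tnth n i).
Proof. by exists (HVar i). Qed.

Lemma hrepG_hrep r (f : r.-tuple nat -> nat) : hrepG f -> hrep f.
Proof. by move=> [E [aE _ eE]]; exists E. Qed.

Lemma hrep_GP r j (f g : r.-tuple nat -> nat) :
  hrep f -> hrep g -> (forall n, 1 < f n) ->
  hrepG (fun n => GP j (f n) (g n)).
Proof.
move=> [E1 [a1 e1]] [E2 [a2 e2]] f_gt1; exists (HGP j E1 E2).
by split=> //= [|n]; rewrite ?e1 ?e2 //; split=> // n; rewrite e1.
Qed.

Lemma hrepG_ext r (f g : r.-tuple nat -> nat) : f =1 g -> hrepG f -> hrepG g.
Proof. by move=> fg [E [aE uE eE]]; exists E; split=> // n; rewrite eE. Qed.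

Lemma hrepG_add r (f g : r.-tuple nat -> nat) :
  hrepG f -> hrep g -> hrepG (fun n => f n + g n).
Proof.
move=> [E1 [a1 u1 e1]] [E2 [a2 e2]]; exists (HAdd E1 E2).
by split=> //= [|n]; rewrite ?u1 // e1 e2.
Qed.

Lemma hrepG_sub r (f g : r.-tuple nat -> nat) :
  hrepG f -> hrep g -> hrepG (fun n => f n - g n).
Proof.
move=> [E1 [a1 u1 e1]] [E2 [a2 e2]]; exists (HMonus E1 E2).
by split=> //= [|n]; rewrite ?u1 // e1 e2.
Qed.

Lemma hrepG_mul r (f g : r.-tuple nat -> nat) :
  hrepG f -> hrep g -> hrepG (fun n => f n * g n).
Proof.
move=> [E1 [a1 u1 e1]] [E2 [a2 e2]]; pose two := HCst r 2.
exists (HQuo (HMonus (HMonus (HPow (HAdd E1 E2) two) (HPow E1 two))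
                     (HPow E2 two)) two).
split=> //= [|n]; first by rewrite u1.
by rewrite e1 e2 sqrnD -subnDA addKn mulKn.
Qed.

Lemma hrep_peval r X (E : expoly r X) (e : r.-tuple nat -> X -> nat) :
  (forall x, hrep (fun n => e n x)) -> hrep (fun n => peval E n (e n)).
Proof.
move=> he; have CC := hrep_closed r.
elim: E => [i|x|c|E1 h1 E2 h2|E1 h1 E2 h2|x] /=; solve_closed CC => //.
exact: hrep_var.
Qed.

(** Exchanging sum and product: since the index of c is the sum of
    c x * B ^ rank x, the sum over the box is the product over the unknowns of
    geometric progressions with ratios 2^beta Z^(B^rank). *)
Lemma hrep_mono_box_sum r (X : finType) (m : mono r X)
    (b Z : r.-tuple nat -> nat) :
  0 < #|X| -> hrep b -> hrep Z -> (forall n, 1 < Z n) ->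
  hrepG (fun n => \sum_(c : {ffun X -> 'I_(b n).+1})
                     mono_eval m n (fun x => c x) * Z n ^ box_index c).
Proof.
move=> /card_gt0P[x0 _] hb hZ Z_gt1; have CC := hrep_closed r.
pose F x n := GP (m.1.2 x) (2 ^ m.2 x * Z n ^ (b n).+1 ^ enum_rank x) (b n).
have hF x : hrepG (F x).
  apply: hrep_GP => [||n]; [by solve_closed CC | exact: hb |].
  have : 0 < 2 ^ m.2 x by rewrite expn_gt0.
  have : 1 < Z n ^ (b n).+1 ^ enum_rank x.
    by rewrite -(expn0 (Z n)) ltn_exp2l ?expn_gt0.
  nia.
apply: (@hrepG_ext _ (fun n => F x0 n *
    (\prod_(x <- index_enum X | x != x0) F x n
       * peval m.1.1 n (of_void _)))) => [n|].
  rewrite mulnA.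
  rewrite -[_ * \prod_(_ <- _ | _) _](bigD1 x0 (F := F^~ n) (P := xpredT)) //.
  rewrite mulnC.
  rewrite /F /GP bigA_distr_bigA big_distrr /=; apply: eq_bigr => c _.
  rewrite /mono_eval -mulnA /box_index expn_sum -big_split /=; congr (_ * _).
  apply: eq_bigr => x _; rewrite expnMn -mulnA; congr (_ * (_ * _)).
  by rewrite -expnM mulnC.
apply: hrepG_mul => //; apply: (closed_mul CC).
  by apply: (closed_prod CC) => x; apply: hrepG_hrep.
by apply: hrep_peval => -[].
Qed.

Lemma hrep_box_sum r (X : finType) (E : expoly r X)
    (b Z : r.-tuple nat -> nat) :
  0 < #|X| -> hrep b -> hrep Z -> (forall n, 1 < Z n) ->
  hrepG (fun n => \sum_(c : {ffun X -> 'I_(b n).+1})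
                     peval E n (fun x => c x) * Z n ^ box_index c).
Proof.
move=> X_gt0 hb hZ Z_gt1.
apply: (@hrepG_ext _ (fun n => \sum_(m <- monos E)
    \sum_(c : {ffun X -> 'I_(b n).+1})
      mono_eval m n (fun x => c x) * Z n ^ box_index c)) => [n|].
  rewrite exchange_big /=; apply: eq_bigr => c _.
  by rewrite -big_distrl /= sum_monos.
have hm m := hrep_mono_box_sum m X_gt0 hb hZ Z_gt1.
case: (monos E) (monos_neq_nil E) => // m s _.
apply: hrepG_ext (hrepG_add (hm m) _) => [n|]; first by rewrite big_cons.
by apply: (closed_sum (hrep_closed r)) => m'; apply: hrepG_hrep.
Qed.

(** * Counting the solutions of a system in a box *)

Definition sum_squares r X (L : system r X) : expoly r X :=
  foldr (fun p => EAdd (EAdd (EMul p.1 p.1) (EMul p.2 p.2))) (ECst 0) L.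

Definition sum_cross r X (L : system r X) : expoly r X :=
  foldr (fun p => EAdd (EMul (ECst 2) (EMul p.1 p.2))) (ECst 0) L.

(** The difference of the two polynomials is the sum of the squares of the
    defects of the equations; the parts of positive and negative sign are kept
    apart, as exponential polynomials have no subtraction. *)
Lemma leqif_sum_squares r X (L : system r X) n e :
  peval (sum_cross L) n e <= peval (sum_squares L) n e ?= iff holds L n e.
Proof.
elim: L => [|p L IHL] /=; first exact/leqif_refl.
by apply: leqif_add IHL; rewrite !mulnn; apply: nat_Cauchy.
Qed.

(** The digits are the values of [sum_squares] minus [sum_cross], which vanish
    at the solutions. Expressions being monotone, the value of [sum_squares] at
    the far corner of the box bounds them, and 2^u is above that value. *)
Lemma hrep_count r (X : finType) (L : system r X) (b : r.-tuple nat -> nat) :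
  0 < #|X| -> hrep b ->
  exists E : hgterm r,
    [/\ admissible E, uses_HW E && uses_GP E
      & forall n, heval E n = #|[set c : {ffun X -> 'I_(b n).+1}
                                 | holds L n (fun x => c x)]|].
Proof.
move=> X_gt0 hb; have CC := hrep_closed r.
pose u n := (peval (sum_squares L) n (fun=> b n)).+1.
have hu : hrep u by apply: (closed_succ CC); apply: hrep_peval.
pose Z n := 2 ^ (2 * u n).
have hZ : hrep Z by rewrite /Z; solve_closed CC.
have Z_gt1 n : 1 < Z n by rewrite -(expn0 2) ltn_exp2l // mulnS.
have hS := hrep_box_sum (sum_squares L) X_gt0 hb hZ Z_gt1.
have hT := hrepG_hrep (hrep_box_sum (sum_cross L) X_gt0 hb hZ Z_gt1).
have hones : hrep (fun n => 2 ^ u n - 1) by solve_closed CC.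
have [E [aE uE eE]] := hrepG_mul (hrepG_sub hS hT) hones.
have [Eu [au eu]] := hu.
have [EB [aB eB]] : hrep (fun n => (b n).+1 ^ #|X|) by solve_closed CC.
exists (HMonus EB (HQuo (HHW E) Eu)).
split=> //= [|n]; first by rewrite uE !orbT.
rewrite eB eu eE -sumnB; last first.
  by move=> c _; rewrite leq_mul2r (leqif_sum_squares L) orbT.
pose d (c : {ffun X -> 'I_(b n).+1}) :=
  peval (sum_squares L) n (fun x => c x) - peval (sum_cross L) n (fun x => c x).
under eq_bigr do rewrite -mulnBl -/(d _).
rewrite mulnC subn1 HW_count_nonzero_box // => [|c]; last first.
  apply: leq_trans (leq_subr _ _) _.
  apply: leq_trans (ltnW (ltn_expl _ (isT : 1 < 2))).
  by apply/leqW/peval_le => x; rewrite -ltnS.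
rewrite mulKn // -[X in X ^ _]card_ord -card_ffun [RHS]cardsCs.
congr (_ - _); apply: eq_card => c; rewrite !inE.
have le_sq := leqif_sum_squares L n (fun x => c x).
by rewrite subn_eq0 (geq_leqif le_sq).
Qed.

(** * Arithmetic terms for the Hamming weight and the progressions *)

Lemma aeval_subst m r (T : aterm m) (s : m.-tuple (aterm r)) n :
  aeval (asubst T s) n = aeval T (map_tuple (fun U => aeval U n) s).
Proof.
elim: T => //= [i|T1 -> T2 ->|T1 -> T2 ->|T1 -> T2 ->|T1 -> T2 ->] //.
by rewrite tnth_map.
Qed.

Definition arep r (f : r.-tuple nat -> nat) : Type :=
  {T : aterm r | forall n, aeval T n = f n}.

Lemma arep_closed r : arith_closed (@arep r).
Proof.
split=> [f g fg [T eT]|c|f g|f g|f g|f g].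
- by exists T => n; rewrite eT.
- by exists (ACst c).
all: move=> [T1 e1] [T2 e2].
- by exists (AAdd T1 T2) => n /=; rewrite e1 e2.
- by exists (AMonus T1 T2) => n /=; rewrite e1 e2.
- by exists (AQuo T1 T2) => n /=; rewrite e1 e2.
- by exists (APow T1 T2) => n /=; rewrite e1 e2.
Qed.

Lemma arep_var r i : arep (fun n : r.-tuple nat => tnth n i).
Proof. by exists (AVar i). Qed.

Lemma ex_represents_HW : {hw | represents_HW hw}.
Proof.
have [hw hwE] := closed_HW (arep_closed 1) (arep_var ord0).
by exists hw => x; rewrite hwE.
Qed.

Lemma ex_represents_GP j : {g | represents_GP j g}.
Proof.
have CC := arep_closed 2.
(* The ratio is replaced by one that always exceeds one. *)
have hq : arep (fun n : 2.-tuple nat => 2 + (tnth n ord0 - 2)).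
  by solve_closed CC; apply: arep_var.
have [g gE] : arep (fun n : 2.-tuple nat =>
    GP j (2 + (tnth n ord0 - 2)) (tnth n ord_max)).
  by apply: (closed_GP CC) => //; apply: arep_var.
by exists g => q t q_gt1; rewrite gE /= subnKC.
Qed.

(** Admissibility is needed because the terms gp are only known to be correct
    for ratios above one. *)
Lemma aeval_expand hw gp r (E : hgterm r) n :
  represents_HW hw -> (forall j, represents_GP j (gp j)) -> admissible E ->
  aeval (expand hw gp E) n = heval E n.
Proof.
move=> hwP gpP; elim: E => //=.
1-4: by move=> E1 IH1 E2 IH2 [/IH1-> /IH2->].
- move=> E IH aE; rewrite aeval_subst -(IH aE) -hwP; congr aeval.
  exact: val_inj.
- move=> j E1 IH1 E2 IH2 [a1 a2 gt1]; rewrite aeval_subst -IH1 // -IH2 // -gpP.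
    by congr aeval; apply: val_inj.
  by rewrite IH1.
Qed.

(** * Reduction to a system of equations *)

Fixpoint hg_of_aterm r (T : aterm r) : hgterm r :=
  match T with
  | AVar i => HVar i
  | ACst c => HCst r c
  | AAdd T1 T2 => HAdd (hg_of_aterm T1) (hg_of_aterm T2)
  | AMonus T1 T2 => HMonus (hg_of_aterm T1) (hg_of_aterm T2)
  | AQuo T1 T2 => HQuo (hg_of_aterm T1) (hg_of_aterm T2)
  | APow T1 T2 => HPow (hg_of_aterm T1) (hg_of_aterm T2)
  end.

Lemma hrep_aterm r (T : aterm r) : hrep (aeval T).
Proof.
exists (hg_of_aterm T); split; first by elim: T => //=.
by move=> n; elim: T => //= T1 -> T2 ->.
Qed.

Definition sum_part r (sgn : bool) (P : algebraic_sum r) : aterm r :=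
  foldr (fun s T => if s.1 == sgn then AAdd s.2 T else T) (ACst 0) P.

Lemma sum_eval_eq0 r (P : algebraic_sum r) n :
  (sum_eval P n == 0%R) =
  (aeval (sum_part false P) n == aeval (sum_part true P) n).
Proof.
have -> : sum_eval P n = ((aeval (sum_part false P) n)%:Z
                          - (aeval (sum_part true P) n)%:Z)%R.
  rewrite /sum_eval; elim: P => [|[[] T] P IHP]; first by rewrite big_nil.
    by rewrite big_cons IHP /=; lia.
  by rewrite big_cons IHP /=; lia.
by rewrite GRing.subr_eq0.
Qed.

(** The unknowns range over all natural numbers here: x < t is expressed as the
    vanishing of (x + 1) - t. *)
Definition defect r k (P : algebraic_sum (r + k)) (t : aterm r) :
    aterm (r + k) :=
  let Tp := sum_part false P in
  let Tn := sum_part true P in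
  let t' := asubst t [tuple AVar (lshift k i) | i < r] in
  AAdd (AAdd (AMonus Tp Tn) (AMonus Tn Tp))
    (foldr (fun j => AAdd (AMonus (AAdd (AVar (rshift r j)) (ACst 1)) t'))
       (ACst 0) (enum 'I_k)).

Lemma defect_eq0 r k (P : algebraic_sum (r + k)) (t : aterm r) n
    (e : 'I_k -> nat) :
  aeval (defect P t) (cat_tuple n (mktuple e)) = 0 <->
  sum_eval P (cat_tuple n (mktuple e)) = 0%R /\ forall j, e j < aeval t n.
Proof.
set v := cat_tuple n _.
have et : aeval (asubst t [tuple AVar (lshift k i) | i < r]) v = aeval t n.
  rewrite aeval_subst; congr aeval; apply: eq_from_tnth => i.
  by rewrite tnth_map tnth_mktuple /= tnth_lshift.
have -> : aeval (defect P t) v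
  = (aeval (sum_part false P) v - aeval (sum_part true P) v)
    + (aeval (sum_part true P) v - aeval (sum_part false P) v)
    + \sum_(j <- enum 'I_k) ((e j).+1 - aeval t n).
  rewrite /=; congr (_ + _); elim: (enum _) => [|j s IHs] /=.
    by rewrite big_nil.
  by rewrite big_cons IHs et tnth_rshift tnth_mktuple addn1.
have -> : (sum_eval P v = 0%R)
    <-> aeval (sum_part false P) v = aeval (sum_part true P) v.
  by rewrite (rwP eqP) sum_eval_eq0 -(rwP eqP).
rewrite big_enum; split=> [/eqP|[-> lt_e]].
  rewrite !addn_eq0 sum_nat_eq0 => /andP[/andP[le1 le2] /forallP le3].
  split; first by apply/eqP; rewrite eqn_leq; apply/andP.
  by move=> j; have := le3 j; rewrite inE.
by rewrite subnn big1 // => j _; apply/eqP; apply: lt_e.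
Qed.

(** A solution is completed by the values of its auxiliary unknowns. Its
    coordinates are below t, so that t plus the sum of the parameters bounds
    all arguments, and the tower over it bounds the completed solution. *)
Lemma card_solutions_box r k (P : algebraic_sum (r + k)) (t : aterm r) :
  exists (Y : finType) (L : system r ('I_k + Y)) (d : nat),
  forall n, let b := tower d (aeval t n + \sum_i tnth n i) in
    #|solutions P n (aeval t n)|
      = #|[set c : {ffun 'I_k + Y -> 'I_b.+1} | holds L n (fun x => c x)]|.
Proof.
have [Y [L [V [W [d [LW VW le_d]]]]]] := definable_aterm (defect P t).
exists Y, ((V, ECst 0) :: L), d => n; set s := _ + _ => b.
have le_n i : tnth n i <= s by rewrite /s (bigD1 i) //= addnCA leq_addr.
pose ea (a : k.-tuple 'I_(aeval t n)) j : nat := tnth a j.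
pose F a : {ffun 'I_k + Y -> 'I_b.+1} :=
  [ffun z => inord (env2 (ea a) (W n (ea a)) z)].
have le_ea a j : ea a j <= s.
  by apply: leq_trans (leq_addr _ _); apply/ltnW/ltn_ord.
have FE a : (fun x => F a x : nat) =1 env2 (ea a) (W n (ea a)).
  move=> z; rewrite ffunE inordK // ltnS; case: z => [j|y] /=.
    exact: leq_trans (le_ea a j) (le_tower d s).
  by have [] := le_d n (ea a) s le_n (le_ea a).
have F_inj : injective F.
  move=> a1 a2 e12; apply: eq_from_tnth => j; apply: val_inj.
  by have := FE a1 (inl j); rewrite e12 FE.
have tup a : map_tuple (@nat_of_ord _) a = mktuple (ea a).
  by apply: eq_from_tnth => j; rewrite tnth_map tnth_mktuple.
rewrite -(card_imset _ F_inj); apply: eq_card => c; rewrite inE.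
apply/imsetP/idP => [[a + ->]|].
  rewrite inE tup => /eqP sol_a; rewrite (holds_ext _ _ (FE a)) /=.
  apply/andP; split; last by apply/LW.
  by rewrite VW; apply/eqP/defect_eq0; split=> // j; apply: ltn_ord.
pose e j : nat := c (inl j); pose w y : nat := c (inr y).
have cE : (fun x => c x : nat) =1 env2 e w by case.
rewrite (holds_ext _ _ cE) /= => /andP[/eqP V0 hL]; have wE := (LW _ _ _).1 hL.
have eV0 : peval V n (env2 e (W n e)) = 0.
  by rewrite -V0; apply: peval_ext => -[j|y] //=; rewrite -wE.
move: eV0; rewrite VW => /defect_eq0[sol lt_e].
pose a := [tuple Ordinal (lt_e j) | j < k].
have eaE : ea a =1 e by move=> j; rewrite /ea tnth_mktuple.
exists a.
  rewrite inE tup; apply/eqP; rewrite -sol; congr (sum_eval P (cat_tuple n _)).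
  by apply: eq_from_tnth => j; rewrite !tnth_mktuple.
have wEa : w =1 W n (ea a).
  apply/LW; rewrite (holds_ext _ _ (_ : _ =1 env2 e w)) // => -[j|y] //=.
apply/ffunP => z; apply: val_inj; rewrite /= (FE a z).
by case: z => [j|y] /=; rewrite ?eaE -?wEa.
Qed.

Theorem theorem3p4 (r k : nat) (P : algebraic_sum (r + k)) (t : aterm r)
    (k_gt0 : 0 < k) (t_gt1 : forall n : r.-tuple nat, 1 < aeval t n) :
  exists T : aterm r,
    built_from_HW_GP T /\
    forall n : r.-tuple nat, aeval T n = #|solutions P n (aeval t n)|.
Proof.
have [Y [L [d cardL]]] := card_solutions_box P t.
pose b n := tower d (aeval t n + \sum_i tnth n i).
have hb : hrep b.
  have CC := hrep_closed r; rewrite /b; elim: (d) => [|d' IHd] /=.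
    apply: (closed_add CC); first exact: hrep_aterm.
    by apply: (closed_sum CC) => i; apply: hrep_var.
  exact: (closed_exp CC) (closed_cst CC 2) IHd.
have X_gt0 : 0 < #|{: 'I_k + Y}| by rewrite card_sum card_ord addn_gt0 k_gt0.
have [E [aE uE eE]] := hrep_count L X_gt0 hb.
have [hw hwP] := ex_represents_HW.
pose gp j := sval (ex_represents_GP j).
have gpP j : represents_GP j (gp j) by apply: (svalP (ex_represents_GP j)).
exists (expand hw gp E); split; first by exists hw, gp, E.
by move=> n; rewrite aeval_expand // eE cardL.
Qed.
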